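(* Let $\{p(\cdot;\vartheta)\}_{\vartheta\in\Omega}$ be a $\lambda$-exponential family on a set $\mathcal{Y}\subset\mathbb{R}^d$ with statistic $F(y)=y$, satisfying the standing assumptions of the context and the representation $p(y;\vartheta)=e^{-\mathbf{L}_{\lambda,\psi_\lambda}[y:\eta]+\psi_\lambda(y)}$ for $y\in\mathcal{Y}$, $\vartheta\in\Omega$, $\eta=\nabla^{c_\lambda}\varphi_\lambda(\vartheta)$. Let $\vartheta\in\Omega$, let $\eta=\nabla^{c_\lambda}\varphi_\lambda(\vartheta)$ be its dual variable, and let $Y$ have density $p(\cdot;\vartheta)$ under $\mathbb{E}_\vartheta$. Then $\eta$ is the unique right barycenter of the distribution $p(\cdot;\vartheta)$: $$\eta=\operatorname*{arg\,min}_{\eta'\in\Omega'}\ \mathbb{E}_\vartheta\left[\mathbf{L}_{\lambda,\psi_\lambda}[Y:\eta']\right].$$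
   Context: Let $\lambda<1$, $\lambda\neq0$, $q=1-\lambda$. Let $\nu$ be a measure on $\mathbb{R}^d$. The $\lambda$-exponential family with $F(y)=y$ has potential $\varphi_\lambda(\vartheta)=\log\int[1+\lambda\vartheta\cdot y]_+^{1/\lambda}d\nu(y)$ (with $t_+=\max\{t,0\}$, $0^s=\infty$ for $s<0$), natural parameter set $\Omega=\{\vartheta:\varphi_\lambda(\vartheta)<\infty\}$, and densities $p(y;\vartheta)=[1+\lambda\vartheta\cdot y]_+^{1/\lambda}e^{-\varphi_\lambda(\vartheta)}$ with respect to $\nu$. Standing assumptions: $\Omega$ is a non-empty open convex set; $\varphi_\lambda$ is finite and smooth on $\Omega$ and can be differentiated under the integral sign (in particular $\nabla e^{\varphi_\lambda(\vartheta)}=\int[1+\lambda\vartheta\cdot y]_+^{1/\lambda-1}y\,d\nu(y)$ with integrable integrand); the Hessian of $\frac1\lambda(e^{\lambda\varphi_\lambda}-1)$ is strictly positive definite and $1-\lambda\nabla\varphi_\lambda(\vartheta)\cdot\vartheta>0$ on $\Omega$; the support $\mathcal{Y}=\{y:p(y;\vartheta)>0\}$ is independent of $\vartheta$. $\lambda$-gradient: $\nabla^{c_\lambda}f(u)=\frac{\nabla f(u)}{1-\lambda\nabla f(u)\cdot u}$; under the assumptions $\nabla^{c_\lambda}\varphi_\lambda$ is a diffeomorphism from $\Omega$ onto an open set $\Omega'$, and $\eta=\nabla^{c_\lambda}\varphi_\lambda(\vartheta)$ is the dual parameter. The $\lambda$-conjugate is $\psi_\lambda(v)=\sup_{\vartheta\in\Omega}\{\frac1\lambda\log(1+\lambda\vartheta\cdot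 v)-\varphi_\lambda(\vartheta)\}$ (with $\log t=-\infty$ for $t\le0$), which is smooth on $\Omega'$; it is assumed that $\psi_\lambda(y)$ is finite for $y\in\mathcal{Y}$. The $\lambda$-logarithmic divergence is $\mathbf{L}_{\lambda,\psi_\lambda}[y:\eta']=\psi_\lambda(y)-\psi_\lambda(\eta')-\frac1\lambda\log\left(1+\lambda\nabla\psi_\lambda(\eta')\cdot(y-\eta')\right)$ for $\eta'\in\Omega'$; it takes values in $[0,\infty]$.
   Formalization: Uniqueness of the minimizer is asserted when the expected divergence is finite somewhere on Ω' (it can be identically +∞, and then every point minimizes); minimality of η and strict positivity of the expected excess divergence hold without this proviso. *)

(* Defs.v *)
From HB Require Import structures.
From mathcomp Require Import all_boot all_order all_algebra.
From mathcomp Require Import all_classical all_reals all_analysis.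

Set Implicit Arguments.
Unset Strict Implicit.
Unset Printing Implicit Defensive.

Import Order.TTheory GRing.Theory Num.Theory.
Import numFieldNormedType.Exports.

Local Open Scope classical_set_scope.
Local Open Scope ring_scope.

Section calculus.
Context {R : realType} {d : nat}.
Implicit Types (u v : 'rV[R]_d) (f : 'rV[R]_d -> R) (A : set 'rV[R]_d).

Definition dot u v : R := \sum_i u 0 i * v 0 i.

Definition partial (i : 'I_d) f u : R := 'D_(delta_mx 0 i) f u.

Definition grad f u : 'rV[R]_d := \row_i partial i f u.

Definition hessian f u : 'M[R]_d := \matrix_(i, j) partial i (partial j f) u.

Definition posdefmx (H : 'M[R]_d) : Prop :=
  forall v, v != 0 -> 0 < dot (v *m H) v.

(* Meant for open A: derivatives are unrestricted, not relative to A. *)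
Fixpoint class_C (k : nat) A f : Prop :=
  if k is k'.+1 then
    (forall u, A u -> differentiable f u) /\
    (forall i, class_C k' A (partial i f))
  else forall u, A u -> {for u, continuous f}.

Definition smooth_on A f : Prop := forall k, class_C k A f.

(* The lambda-gradient. *)
Definition cgrad (lam : R) f u : 'rV[R]_d :=
  (1 - lam * dot (grad f u) u)^-1 *: grad f u.

End calculus.

(* R^d with its Borel sigma-algebra. *)
Definition borel (R : realType) (d : nat) :=
  g_sigma_algebraType (@open 'rV[R]_d).

(* t_+ ^ s with 0 ^ s = +oo for s < 0. Only s = 1/lam and s = 1/lam - 1 are
   used, and neither is 0 when lam < 1 and lam != 0. *)
Definition ppow {R : realType} (t s : R) : \bar R :=
  if 0 < t then (t `^ s)%:E else if s < 0 then +oo%E else 0%E.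

Definition argmin {R : realType} {T : Type} (A : set T) (f : T -> \bar R)
    : set T :=
  [set x | A x /\ forall z, A z -> (f x <= f z)%E].

Section lambda_family.
Context {R : realType} {d : nat}.
Variables (lam : R) (nu : {measure set (borel R d) -> \bar R}).
Implicit Types (theta y v eta : 'rV[R]_d).

Definition potential theta : \bar R :=
  lne (\int[nu]_y ppow (1 + lam * dot theta y) lam^-1).

Definition nat_params : set 'rV[R]_d :=
  [set theta | (potential theta < +oo)%E].

(* [potential] is finite on [nat_params] under the standing assumptions. *)
Definition rpotential theta : R := fine (potential theta).

(* May be +oo outside the support when lam < 0. *)
Definition density theta y : \bar R :=
  (ppow (1 + lam * dot theta y) lam^-1 * expeR (- potential theta))%E.

(* E_theta[g(Y)] for Y with density [density theta] with respect to nu. *)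
Definition expect theta (g : 'rV[R]_d -> \bar R) : \bar R :=
  (\int[nu]_y (g y * density theta y))%E.

Definition dual_param theta : 'rV[R]_d := cgrad lam rpotential theta.

Definition dual_params : set 'rV[R]_d := dual_param @` nat_params.

(* [lne t] is -oo for t <= 0. *)
Definition conjugate v : \bar R :=
  ereal_sup
    [set (lam^-1%:E * lne (1 + lam * dot theta v)%:E - potential theta)%E
    | theta in nat_params].

Definition rconjugate v : R := fine (conjugate v).

(* The lambda-logarithmic divergence L[y : eta] of the conjugate. *)
Definition log_div y eta : \bar R :=
  (conjugate y - conjugate eta
   - lam^-1%:E * lne (1 + lam * dot (grad rconjugate eta) (y - eta))%:E)%E.

(* The family is carried by the set Y. The expression for [density] makes sense
   on all of R^d, also where nu puts no mass, so that Y is the common support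
   only up to a nu-null set; see [sa_support_sub] and [sa_support_ae]. *)
Record standing_assumptions (Y : set 'rV[R]_d) : Prop := {
  sa_nonempty : nat_params !=set0;
  sa_open : open nat_params;
  sa_convex : convex_set (nat_params : set (convex_lmodType 'rV[R]_d));
  sa_finite : forall theta, nat_params theta -> potential theta \is a fin_num;
  sa_smooth : smooth_on nat_params rpotential;
  sa_integrable : forall theta, nat_params theta -> forall i,
    nu.-integrable setT (fun y : borel R d =>
      ppow (1 + lam * dot theta y) (lam^-1 - 1) * ((y : 'rV[R]_d) 0 i)%:E)%E;
  sa_diff_under_int : forall theta, nat_params theta -> forall i,
    (grad (fun t => expR (rpotential t)) theta 0 i)%:E =
    (\int[nu]_y (ppow (1 + lam * dot theta y) (lam^-1 - 1)
                 * ((y : 'rV[R]_d) 0 i)%:E))%E;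
  sa_hessian : forall theta, nat_params theta ->
    posdefmx
      (hessian (fun t => lam^-1 * (expR (lam * rpotential t) - 1)) theta);
  sa_pos : forall theta, nat_params theta ->
    0 < 1 - lam * dot (grad rpotential theta) theta;
  sa_support_sub : forall theta, nat_params theta ->
    forall y, Y y -> (0 < density theta y)%E;
  sa_support_ae : forall theta, nat_params theta ->
    {ae nu, forall y, (0 < density theta y)%E -> Y y};
  sa_conjugate_finite : forall y, Y y -> conjugate y \is a fin_num
}.

End lambda_family.

(* Main.v *)
Require Import Defs.
From HB Require Import structures.
From mathcomp Require Import all_boot all_order all_algebra.
From mathcomp Require Import all_classical all_reals all_analysis.
From mathcomp Require Import measurable_realfun ring lra.

Set Implicit Arguments.
Unset Strict Implicit.
Unset Printing Implicit Defensive.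

Import Order.TTheory GRing.Theory Num.Theory.
Import numFieldNormedType.Exports.

Local Open Scope classical_set_scope.
Local Open Scope ring_scope.

(** By the representation, L[y : eta'] - L[y : eta] is the log-likelihood ratio
    log (p(y; theta) / p(y; theta')), so that the excess risk of
    eta' = eta(theta') over eta is a Kullback-Leibler divergence: it is
    nonnegative, and it vanishes only if p(.; theta) = p(.; theta') almost
    everywhere. In that case the bases 1 + lam theta.y and 1 + lam theta'.y are
    proportional, hence so are the weights w = (1 + lam theta.y)^(1/lam - 1)
    attached to theta and theta'. Differentiating under the integral sign gives
    eta = (\int w y d nu) / (\int w d nu), which then takes the same value at
    both parameters. *)

(** * Gibbs inequality for losses that differ by a log-likelihood ratio *)

Section gibbs.
Context {d : measure_display} {T : measurableType d} {R : realType}.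
Variable mu : {measure set T -> \bar R}.
Local Open Scope ereal_scope.

(** This is exp x >= 1 + x at x = ln (b / a), multiplied by [a]. *)
Lemma subr_le_ln_ratio (a b : R) : (0 < a)%R -> (0 < b)%R ->
  (a - b <= (ln a - ln b) * a)%R.
Proof.
move=> a0 b0; have := expR_ge1Dx (ln b - ln a).
rewrite expRB !lnK ?posrE// ler_pdivlMr// => h; lra.
Qed.

(** Equality case of [subr_le_ln_ratio]: exp x > 1 + x as soon as x != 0. *)
Lemma ln_ratio_eq (a b : R) : (0 < a)%R -> (0 < b)%R ->
  ((ln a - ln b) * a = a - b)%R -> a = b.
Proof.
move=> a0 b0 ab; apply: ln_inj; rewrite ?posrE//.
apply/eqP; rewrite -subr_eq0; apply/negPn/negP => ab0.
have : (ln b - ln a)%R != 0%R by rewrite -opprB oppr_eq0.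
move=> /expR_gt1Dx; rewrite expRB !lnK ?posrE// ltr_pdivlMr// => h; lra.
Qed.

(* Pointwise condition: off the common support of the densities [p] and [p']
   the losses [l] and [l'] are unconstrained and may be infinite. *)
Definition log_ratio_losses (p p' l l' : \bar R) : Prop :=
  p = 0 /\ p' = 0 \/
  exists a a' b b' : R,
    [/\ [/\ p = a%:E, p' = a'%:E, l = b%:E & l' = b'%:E],
        [/\ (0 < a)%R, (0 < a')%R, (0 <= b)%R & (0 <= b')%R]
      & (b' - b = ln a - ln a')%R].

Record loss_comparison (p p' l l' : T -> \bar R) : Prop := {
  measurable_density1 : measurable_fun setT p;
  measurable_density2 : measurable_fun setT p';
  measurable_loss1 : measurable_fun setT l;
  measurable_loss2 : measurable_fun setT l';
  density1_ge0 : forall x, 0 <= p x;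
  density2_ge0 : forall x, 0 <= p' x;
  density1_mass : \int[mu]_x p x = 1;
  density2_mass : \int[mu]_x p' x = 1;
  ae_log_ratio : {ae mu, forall x, log_ratio_losses (p x) (p' x) (l x) (l' x)}
}.

Variables p p' l l' : T -> \bar R.
Hypothesis comp : loss_comparison p p' l l'.

Let mp := measurable_density1 comp.
Let mp' := measurable_density2 comp.
Let ml := measurable_loss1 comp.
Let ml' := measurable_loss2 comp.
Let p_ge0 := density1_ge0 comp.
Let p'_ge0 := density2_ge0 comp.
Let p_mass := density1_mass comp.
Let p'_mass := density2_mass comp.
Let losses := ae_log_ratio comp.

(** Almost everywhere [h] is p ln (p / p'), the integrand of the Kullback-Leibler divergence, and h
    + p' - p >= 0 by [subr_le_ln_ratio]. The positive part in [g] makes this sign hold everywhere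
    and alters the sum only on a null set. *)
Let h x := (l' x - l x) * p x.
Let g := (fun x => h x + p' x - p x)^\+.

Let mh : measurable_fun setT h.
Proof. by apply: emeasurable_funM => //; apply: emeasurable_funB. Qed.

Let mg : measurable_fun setT g.
Proof.
by apply: measurable_funepos; apply: emeasurable_funB => //;
  apply: emeasurable_funD.
Qed.

(* The integrand may have an infinite positive part, so that the identity
   h = g + p - p' is integrated with all terms made nonnegative. *)
Let integral_logratio : \int[mu]_x h x = \int[mu]_x g x.
Proof.
have hE : {ae mu, forall x, [/\ h^\- x <= p' x &
    h^\- x + (g x + p x) = h^\+ x + p' x]}.
  apply: filterS losses => x; rewrite /g !(funeposE, funenegE) /h.
  move=> [[-> ->]|[a [a' [b [b' [[-> -> -> ->]
    [a0 a'0 _ _] bb]]]]]].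
    by rewrite mule0 !add0e oppe0 maxxx add0e.
  rewrite -EFinB -!EFinM -!EFinD -!EFinN -!EFin_max lee_fin bb.
  have := subr_le_ln_ratio a0 a'0.
  set t := (_ * a)%R => at'; split.
    by rewrite ge_max (ltW a'0) andbT; lra.
  congr EFin; rewrite [Order.max (t + _ - _)%R _]max_l; last by lra.
  rewrite !maxEle oppr_le0; case: (leP t 0%R) => t0; case: (leP 0%R t) => t1; lra.
have mhp := measurable_funepos mh; have mhn := measurable_funeneg mh.
(* Since h >= p - p', the negative part of [h] is dominated by [p'], of mass 1. It can thus be
   cancelled below even if the positive part has infinite integral. *)
have hn_fin : \int[mu]_x h^\- x \is a fin_num.
  rewrite ge0_fin_numE; last by apply: integral_ge0 => x _; exact: funeneg_ge0.
  apply: (@le_lt_trans _ _ 1); last exact: ltry.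
  rewrite -p'_mass; apply: ae_ge0_le_integral => //.
  by apply: filterS hE => x [].
have : \int[mu]_x (h^\- x + (g x + p x)) = \int[mu]_x (h^\+ x + p' x).
  apply: ae_eq_integral => //; [|exact: emeasurable_funD|
    by apply: filterS hE => x []].
  by apply: emeasurable_funD => //; exact: emeasurable_funD.
have g0 x : 0 <= g x by exact: funepos_ge0.
have gp0 x : 0 <= g x + p x by exact: adde_ge0.
have mgp : measurable_fun setT (fun x => g x + p x) by exact: emeasurable_funD.
rewrite !ge0_integralD//.
rewrite p_mass p'_mass => /(congr1 (fun z => z - 1)).
rewrite addeA !addeK// => hpE.
by rewrite integralE -hpE [X in X - _]addeC addeK.
Qed.

Lemma integral_logratio_ge0 : 0 <= \int[mu]_x ((l' x - l x) * p x).
Proof.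
by rewrite integral_logratio; apply: integral_ge0 => x _; exact: funepos_ge0.
Qed.

(** The nonnegative [g] then has zero integral, so it vanishes almost everywhere, and [ln_ratio_eq]
    applies pointwise. *)
Lemma integral_logratio_eq0 :
  \int[mu]_x ((l' x - l x) * p x) = 0 -> ae_eq mu setT p p'.
Proof.
rewrite integral_logratio => g0.
have /(ae_eq_integral_abs _ measurableT) gE : measurable_fun setT g := mg.
have {}gE : ae_eq mu setT g (cst 0).
  by apply/gE; rewrite -[RHS]g0; apply: eq_integral => x _;
     rewrite gee0_abs//; exact: funepos_ge0.
apply: filterS2 gE losses => x /(_ I); rewrite /g funeposE /h.
move=> hx [[-> ->]//|[a [a' [b [b' [[pE p'E lE l'E]
    [a0 a'0 _ _] bb]]]]]] _; move: hx; rewrite pE p'E lE l'E.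
rewrite -(EFinB b' b) bb -EFinM -!EFinD -EFin_max => -[] h0; congr EFin.
have ab := subr_le_ln_ratio a0 a'0.
move: h0; rewrite max_l; last by lra.
by move=> h0; apply: ln_ratio_eq => //; lra.
Qed.

Let lp_ge0 : {ae mu, forall x, 0 <= l x * p x}.
Proof.
apply: filterS losses => x [[-> _]|[a [a' [b [b' [[-> _ -> _]
    [a0 a'0 b0 _] _]]]]]]; first by rewrite mule0.
by rewrite mule_ge0 ?lee_fin// ltW.
Qed.

Let l'p_ge0 : {ae mu, forall x, 0 <= l' x * p x}.
Proof.
apply: filterS losses => x [[-> _]|[a [a' [b [b' [[-> _ _ ->]
    [a0 a'0 _ b0] _]]]]]]; first by rewrite mule0.
by rewrite mule_ge0 ?lee_fin// ltW.
Qed.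

(** The products of loss and density are known to be nonnegative only almost everywhere, whereas
    [ge0_integralD] asks for a sign everywhere. *)
Let ae_pos (f : T -> \bar R) : measurable_fun setT f ->
  {ae mu, forall x, 0 <= f x} -> \int[mu]_x f x = \int[mu]_x f^\+ x.
Proof.
move=> mf f0; apply: ae_eq_integral => //; first exact: measurable_funepos.
by apply: filterS f0 => x fx _; rewrite funeposE max_l.
Qed.

Let mlp : measurable_fun setT (fun x => l x * p x).
Proof. exact: emeasurable_funM. Qed.

Let ml'p : measurable_fun setT (fun x => l' x * p x).
Proof. exact: emeasurable_funM. Qed.

(** Almost everywhere l p + p <= l' p + p'. Integrating this and cancelling the common mass 1 avoids
    subtracting risks, which may be infinite. *)
Lemma integral_loss_le : \int[mu]_x (l x * p x) <= \int[mu]_x (l' x * p x).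
Proof.
rewrite (ae_pos mlp lp_ge0) (ae_pos ml'p l'p_ge0).
rewrite -(@leeD2rE _ 1)// -{1}p_mass -p'_mass.
rewrite -!ge0_integralD//; try exact: measurable_funepos.
apply: ae_ge0_le_integral => //; try by move=> x _; apply: adde_ge0.
- by apply: emeasurable_funD => //; exact: measurable_funepos.
- by apply: emeasurable_funD => //; exact: measurable_funepos.
apply: filterS3 losses lp_ge0 l'p_ge0 => x L lp l'p _.
rewrite !funeposE !max_l//.
move: L => [[-> ->]|[a [a' [b [b' [[-> -> -> ->]
    [a0 a'0 _ _] bb]]]]]]; first by rewrite !mule0.
rewrite -!EFinM -!EFinD lee_fin.
have := subr_le_ln_ratio a0 a'0; rewrite -bb; lra.
Qed.

(** With [integral_loss_le] the two risks are equal and finite, so both products are integrable and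
    the integral of the difference splits. *)
Lemma integral_loss_eq : \int[mu]_x (l' x * p x) < +oo ->
  \int[mu]_x (l' x * p x) <= \int[mu]_x (l x * p x) ->
  \int[mu]_x ((l' x - l x) * p x) = 0.
Proof.
move=> l'fin l'l.
have eq_int : \int[mu]_x (l x * p x) = \int[mu]_x (l' x * p x).
  by apply/eqP; rewrite eq_le integral_loss_le.
have ge0_integrable (f : T -> \bar R) : measurable_fun setT f ->
    {ae mu, forall x, 0 <= f x} -> \int[mu]_x f x < +oo ->
    mu.-integrable setT f.
  move=> mf f0 ffin; apply/integrableP; split => //.
  suff -> : \int[mu]_x `|f x| = \int[mu]_x f x by [].
  apply: ae_eq_integral => //; first exact: measurableT_comp.
  by apply: filterS f0 => x fx _; rewrite gee0_abs.
have il' := ge0_integrable _ ml'p l'p_ge0 l'fin.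
have il : mu.-integrable setT (fun x => l x * p x).
  by apply: ge0_integrable => //; rewrite eq_int.
transitivity (\int[mu]_x (l' x * p x - l x * p x)).
  apply: ae_eq_integral => //; first exact: emeasurable_funB.
  apply: filterS losses => x [[-> _]|[a [a' [b [b' [[-> _ -> ->] _ _]]]]]] _.
    by rewrite !mule0 subee.
  by rewrite -EFinB -!EFinM -EFinB mulrBl.
by rewrite integralB// eq_int subee// integrable_fin_num.
Qed.

End gibbs.

(** * Linear forms and Borel measurability on row vectors *)

Section borel_measurability.
Context {R : realType} {d : nat}.
Implicit Types u v y : 'rV[R]_d.

Lemma dotB u v y : dot u (v - y) = dot u v - dot u y.
Proof.
by rewrite /dot -sumrB; apply: eq_bigr => i _; rewrite !mxE mulrBr.
Qed.

(** Meant for two values of [cgrad]: [u], [v] are gradients of the potential, [w], [w'] the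
    denominators, [e], [e'] the factors exp phi, and [k] the ratio of the weights. *)
Lemma proportional_ratio (e e' w w' k : R) u v :
  e != 0 -> e' != 0 -> w' != 0 -> k != 0 -> e * w = k * (e' * w') ->
  (forall i, e * u 0 i = k * (e' * v 0 i)) -> w^-1 *: u = w'^-1 *: v.
Proof.
move=> e0 e'0 w'0 k0 wE uE; apply/rowP => i; rewrite !mxE.
have -> : w = k * (e' * w') / e by rewrite -wE; field.
have -> : u 0 i = k * (e' * v 0 i) / e by rewrite -uE; field.
by field; rewrite e0 w'0 e'0 k0.
Qed.

Lemma continuous_dot u : continuous (dot u).
Proof.
have := @continuous_big R 'I_d +%R 0 xpredT (@add_continuous R) _
  (index_enum 'I_d) (fun i y => u 0 i * y 0 i).
apply=> i _ y; apply: continuousM; first exact: cst_continuous.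
exact: coord_continuous.
Qed.

Lemma open_measurable_borel (A : set 'rV[R]_d) :
  open A -> measurable (A : set (borel R d)).
Proof. by move=> oA; exact: sub_sigma_algebra. Qed.

(** Needed for the conjugate, a supremum over a family that need not be countable: its strict
    superlevel sets are still open. *)
Lemma lower_semicontinuous_measurable_borel (f : borel R d -> \bar R) :
  (forall a : R, open ([set y | (a%:E < f y)%E] : set 'rV[R]_d)) ->
  measurable_fun setT f.
Proof.
move=> of_; apply: (measurability _ (ErealGenOInfty.measurableE R)).
move=> /= _ [_ [a ->]] <-; rewrite setTI; apply: open_measurable_borel.
by rewrite preimage_itvoy; exact: of_.
Qed.

Lemma continuous_measurable_borel (f : 'rV[R]_d -> R) :
  continuous f -> measurable_fun setT (f : borel R d -> R).
Proof.
move=> cf; apply/measurable_EFinP.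
apply: lower_semicontinuous_measurable_borel => a /=.
rewrite (_ : [set _ | _] = f @^-1` [set x | a < x]).
  by apply: open_comp => // y _; exact: cf.
by apply/seteqP; split => y /=; rewrite lte_fin.
Qed.

Lemma measurable_dot u : measurable_fun setT (dot u : borel R d -> R).
Proof. by apply: continuous_measurable_borel; exact: continuous_dot. Qed.

Lemma measurable_affine (a b : R) u :
  measurable_fun setT ((fun y => a + b * dot u y) : borel R d -> R).
Proof.
apply: measurable_funD => //.
apply: measurable_funM; first exact: measurable_cst.
exact: measurable_dot.
Qed.

Lemma open_affine_preimage (b : R) u (A : set R) : open A ->
  open [set y : 'rV[R]_d | A (1 + b * dot u y)].
Proof.
move=> oA; rewrite (_ : [set _ | _] = dot u @^-1` [set r | A (1 + b * r)])//.
apply: open_comp => [y _|]; first exact: continuous_dot.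
rewrite (_ : [set _ | _] = (fun r => 1 + b * r) @^-1` A)//.
apply: open_comp => // r _; apply: continuousD; first exact: cst_continuous.
exact: mulrl_continuous.
Qed.

#[global] Instance ae_filter_borel (nu : {measure set (borel R d) -> \bar R}) :
  Filter (nbhs (almost_everywhere nu)) := ae_filter_ringOfSetsType nu.

End borel_measurability.

(** * Powers and logarithms with extended real values *)

Section extended_reals.
Context {R : realType}.

Lemma ppow_ge0 (t s : R) : (0 <= ppow t s)%E.
Proof. by rewrite /ppow; case: ifP => _; [rewrite lee_fin powR_ge0|case: ifP]. Qed.

Lemma ppow_gt0 (t s : R) : 0 < t -> ppow t s = (t `^ s)%:E.
Proof. by rewrite /ppow => ->. Qed.

Lemma ppow_eq0 (t s : R) : ppow t s = 0%E -> t <= 0 /\ 0 <= s.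
Proof.
rewrite /ppow; case: ltP => [t0 [/eqP]|t0]; first by rewrite gt_eqF ?powR_gt0.
by case: ltP.
Qed.

Lemma powR_mulr_pred (x s : R) : 0 < x -> x `^ s = x `^ (s - 1) * x.
Proof.
move=> x0; rewrite -{3}(powRr1 (ltW x0)) -powRD ?subrK//.
by rewrite (gt_eqF x0) implybT.
Qed.

(** The hypothesis equates two log-densities and gives ln b - ln b' = lam (f - f'); multiplying by
    1/lam - 1 produces the exponent (1 - lam) (f - f'). *)
Lemma powR_proportional (lam b b' f f' : R) : lam != 0 -> 0 < b -> 0 < b' ->
  lam^-1 * ln b - f = lam^-1 * ln b' - f' ->
  b `^ (lam^-1 - 1) = expR ((1 - lam) * (f - f')) * b' `^ (lam^-1 - 1).
Proof.
move=> lam0 b0 b'0 h; rewrite /powR !gt_eqF// -expRD; congr expR.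
have -> : ln b = lam * (lam^-1 * ln b' - f' + f) by rewrite -h; field.
by field.
Qed.

Lemma measurable_ppow d (T : measurableType d) (f : T -> R) (s : R) :
  measurable_fun setT f -> measurable_fun setT (fun x => ppow (f x) s).
Proof.
move=> mf; apply: measurable_fun_ifT.
- by apply: measurable_fun_ltr.
- by apply/measurable_EFinP; exact: measurableT_comp (measurable_powR s) mf.
- exact: measurable_cst.
Qed.

Lemma measurable_lne_EFin d (T : measurableType d) (f : T -> R) :
  measurable_fun setT f -> measurable_fun setT (fun x => lne (f x)%:E).
Proof.
move=> mf; apply: measurable_fun_ifT.
- by apply: measurable_fun_ler.
- exact: measurable_cst.
- by apply/measurable_EFinP; exact: measurableT_comp (@measurable_ln R) mf.
Qed.

(** The set is a ray with endpoint exp (a / k): upward for k > 0, downward for k < 0. In the latter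
    case it contains all t <= 0, where the product is +oo. *)
Lemma open_lt_mul_lne (k a : R) : k != 0 ->
  open [set t : R | (a%:E < k%:E * lne t%:E)%E].
Proof.
move=> k0; have [kp|kn] := ltP 0 k.
  rewrite (_ : [set _ | _] = [set t | expR (k^-1 * a) < t]); first exact: open_gt.
  apply/seteqP; split => t; rewrite /mkset; have [t0|t0] := leP t 0.
  - by rewrite le0_lneNy ?lee_fin// gt0_muleNy ?lte_fin.
  - rewrite lne_EFin// -EFinM lte_fin -ltr_pdivrMl// => h.
    by rewrite -[ltRHS]lnK ?posrE// ltr_expR.
  - by move=> /lt_le_trans /(_ t0); rewrite ltNge expR_ge0.
  - rewrite lne_EFin// -EFinM lte_fin -ltr_pdivrMl// => h.
    by rewrite -ltr_expR lnK ?posrE.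
have {}kn : k < 0 by rewrite lt_neqAle k0.
rewrite (_ : [set _ | _] = [set t | t < expR (k^-1 * a)]); first exact: open_lt.
apply/seteqP; split => t; rewrite /mkset; have [t0|t0] := leP t 0.
- by move=> _; apply: le_lt_trans t0 _; exact: expR_gt0.
- rewrite lne_EFin// -EFinM lte_fin -ltr_ndivlMl// => h.
  by rewrite -[ltLHS]lnK ?posrE// ltr_expR.
- by rewrite le0_lneNy ?lee_fin// lt0_muleNy ?lte_fin// ltry.
- rewrite lne_EFin// -EFinM lte_fin -ltr_ndivlMl// => h.
  by rewrite -ltr_expR lnK ?posrE.
Qed.

End extended_reals.

(** * Densities, divergence and measurability for the lambda-exponential family *)

Section lambda_exponential_family.
Context {R : realType} {d : nat} (lam : R).
Variables (nu : {measure set (borel R d) -> \bar R}) (Y : set 'rV[R]_d).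
Hypothesis lam_lt1 : lam < 1.
Hypothesis lam_neq0 : lam != 0.
Hypothesis SA : standing_assumptions lam nu Y.
Hypothesis repr : forall y theta, Y y -> nat_params lam nu theta ->
  density lam nu theta y =
  expeR (- log_div lam nu y (dual_param lam nu theta) + conjugate lam nu y)%E.

Local Notation Omega := (nat_params lam nu).
Local Notation phi := (rpotential lam nu).
Local Notation base theta y := (1 + lam * dot theta y).
Implicit Types theta y : 'rV[R]_d.

Lemma potentialE theta : Omega theta -> potential lam nu theta = (phi theta)%:E.
Proof. by move=> /(sa_finite SA) /fineK. Qed.

Lemma measurable_base_ppow theta (s : R) :
  measurable_fun setT
    ((fun y => ppow (base theta y) s) : borel R d -> \bar R).
Proof. by apply: measurable_ppow; exact: measurable_affine. Qed.

Lemma integral_ppow theta : Omega theta ->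
  (\int[nu]_y ppow (base theta y) lam^-1 = (expR (phi theta))%:E)%E.
Proof.
move=> /potentialE; rewrite /potential.
have : (0 <= \int[nu]_y ppow (base theta y) lam^-1)%E.
  by apply: integral_ge0 => y _; exact: ppow_ge0.
(* Finiteness of the potential excludes the integrals 0 and +oo, at which [lne] is infinite. *)
case: (integral _ _ _) => [r| |] //= r0; case: ifPn => //; rewrite -ltNge.
by move=> {}r0 [<-]; rewrite lnK.
Qed.

Lemma density_ge0 theta y : (0 <= density lam nu theta y)%E.
Proof. by rewrite mule_ge0 ?ppow_ge0 ?expeR_ge0. Qed.

Lemma measurable_density theta :
  measurable_fun setT (density lam nu theta : borel R d -> \bar R).
Proof.
by apply: emeasurable_funM; [exact: measurable_base_ppow|exact: measurable_cst].
Qed.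

Lemma integral_density theta : Omega theta ->
  (\int[nu]_y density lam nu theta y = 1)%E.
Proof.
move=> Ot; rewrite ge0_integralZr//.
- by rewrite integral_ppow// potentialE//= -EFinM -expRD subrr expR0.
- exact: measurable_base_ppow.
- by move=> y _; exact: ppow_ge0.
- exact: expeR_ge0.
Qed.

(* For [lam < 0] the density is infinite where the base is nonpositive; such
   points are not in [Y] because the conjugate is infinite there as well. *)
Lemma base_gt0 theta y : Omega theta -> Y y -> 0 < base theta y.
Proof.
move=> Ot Yy; rewrite ltNge; apply/negP => b0.
have [lam0|lam0] := ltP 0 lam.
  have := sa_support_sub SA Ot Yy; rewrite /density /ppow (ltNge 0 (_ + _)) b0/=.
  by rewrite invr_lt0 (lt_gtF lam0) mul0e ltxx.
have {}lam0 : lam < 0 by rewrite lt_neqAle lam_neq0.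
suff : conjugate lam nu y = +oo%E.
  by move=> cy; have := sa_conjugate_finite SA Yy; rewrite cy.
apply/eqP; rewrite -leye_eq; apply: ereal_sup_ubound; exists theta => //.
by rewrite le0_lneNy ?lee_fin// lt0_muleNy ?lte_fin ?invr_lt0// potentialE.
Qed.

Local Notation dens theta y :=
  (base theta y `^ lam^-1 * expR (- phi theta)).

Lemma dens_gt0 theta y : Omega theta -> Y y -> 0 < dens theta y.
Proof. by move=> Ot Yy; rewrite mulr_gt0 ?expR_gt0 ?powR_gt0 ?base_gt0. Qed.

Lemma densityE theta y : Omega theta -> Y y ->
  density lam nu theta y = (dens theta y)%:E.
Proof. by move=> Ot Yy; rewrite /density ppow_gt0 ?base_gt0// potentialE. Qed.

Lemma ln_dens theta y : Omega theta -> Y y ->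
  ln (dens theta y) = lam^-1 * ln (base theta y) - phi theta.
Proof.
move=> Ot Yy; rewrite lnM ?posrE ?expR_gt0 ?powR_gt0 ?base_gt0//.
by rewrite ln_powR expRK.
Qed.

(** Logarithm of the representation. An infinite divergence would make the density 0 or +oo, but on
    [Y] it is a positive real. *)
Lemma log_divE theta y : Omega theta -> Y y ->
  log_div lam nu y (dual_param lam nu theta) =
  (rconjugate lam nu y - ln (dens theta y))%:E.
Proof.
move=> Ot Yy; have := repr Yy Ot.
have /fineK <- := sa_conjugate_finite SA Yy.
rewrite densityE// -/(rconjugate lam nu y).
case: (log_div _ _ _ _) => [r| |] //=.
  by move=> [->]; rewrite expRK; congr EFin; lra.
by move=> [] /eqP; rewrite gt_eqF ?dens_gt0.
Qed.

(** The log-density is one of the terms of the supremum defining the conjugate. With [log_divE] this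
    yields nonnegativity of the divergence. *)
Lemma ln_dens_le_rconjugate theta y : Omega theta -> Y y ->
  ln (dens theta y) <= rconjugate lam nu y.
Proof.
move=> Ot Yy; rewrite -lee_fin fineK ?(sa_conjugate_finite SA)//.
apply: ereal_sup_ubound; exists theta => //.
by rewrite lne_EFin ?base_gt0// potentialE// ln_dens// EFinB EFinM.
Qed.

Lemma ae_support theta theta' : Omega theta -> Omega theta' ->
  {ae nu, forall y, Y y \/
    (density lam nu theta y = 0 /\ density lam nu theta' y = 0)%E}.
Proof.
move=> Ot Ot'.
apply: filterS2 (sa_support_ae SA Ot) (sa_support_ae SA Ot') => y Yt Yt'.
have ge0_eq0 (z : \bar R) : (0 <= z)%E -> (0 < z)%E \/ z = 0%E.
  by rewrite le_eqVlt => /predU1P[<-|]; [right|left].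
have [/Yt|p0] := ge0_eq0 _ (density_ge0 theta y); first by left.
have [/Yt'|p'0] := ge0_eq0 _ (density_ge0 theta' y); first by left.
by right; rewrite p0 p'0.
Qed.

(** A strict superlevel set of a supremum is the union of those of its terms, each open by
    [open_lt_mul_lne]. *)
Lemma measurable_conjugate :
  measurable_fun setT (conjugate lam nu : borel R d -> \bar R).
Proof.
apply: lower_semicontinuous_measurable_borel => a.
rewrite (_ : [set _ | _] = \bigcup_(theta in Omega) [set y |
   ((a + phi theta)%:E < lam^-1%:E * lne (base theta y)%:E)%E]).
  apply: bigcup_open => theta Ot.
  apply: (open_affine_preimage (A := [set t | (_ < _ * lne t%:E)%E])).
  by apply: open_lt_mul_lne; rewrite invr_neq0.
have E theta y : Omega theta ->
    ((a + phi theta)%:E < lam^-1%:E * lne (base theta y)%:E)%E =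
    (a%:E < lam^-1%:E * lne (base theta y)%:E - potential lam nu theta)%E.
  by move=> Ot; rewrite potentialE// lteBrDr// EFinD.
apply/seteqP; split => y /=.
  by move=> /ereal_sup_gt[_ [theta Ot <-] h]; exists theta; rewrite //= E.
move=> [theta Ot]; rewrite /= E// => /lt_le_trans; apply.
by apply: ereal_sup_ubound; exists theta.
Qed.

Lemma measurable_log_div (eta : 'rV[R]_d) :
  measurable_fun setT ((fun y => log_div lam nu y eta) : borel R d -> \bar R).
Proof.
apply: emeasurable_funB.
  by apply: emeasurable_funB; [exact: measurable_conjugate|exact: measurable_cst].
apply: emeasurable_funM; first exact: measurable_cst.
apply: measurable_lne_EFin.
rewrite (_ : (fun _ => _) = fun y =>
  (1 - lam * dot (grad (rconjugate lam nu) eta) eta)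
  + lam * dot (grad (rconjugate lam nu) eta) y); first exact: measurable_affine.
by apply/funext => y; rewrite dotB; lra.
Qed.

Lemma ae_log_ratio_losses theta theta' : Omega theta -> Omega theta' ->
  {ae nu, forall y, log_ratio_losses
    (density lam nu theta y) (density lam nu theta' y)
    (log_div lam nu y (dual_param lam nu theta))
    (log_div lam nu y (dual_param lam nu theta'))}.
Proof.
move=> Ot Ot'; apply: filterS (ae_support Ot Ot') => y [Yy|]; last by left.
right; exists (dens theta y), (dens theta' y).
exists (rconjugate lam nu y - ln (dens theta y)).
exists (rconjugate lam nu y - ln (dens theta' y)).
split.
- by split; [exact: densityE|exact: densityE|exact: log_divE|exact: log_divE].
- by split; rewrite ?subr_ge0; [exact: dens_gt0|exact: dens_gt0|
    exact: ln_dens_le_rconjugate|exact: ln_dens_le_rconjugate].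
- by rewrite opprB addrC addrA subrK.
Qed.

Lemma family_comparison theta theta' : Omega theta -> Omega theta' ->
  loss_comparison nu (density lam nu theta) (density lam nu theta')
    (fun y => log_div lam nu y (dual_param lam nu theta))
    (fun y => log_div lam nu y (dual_param lam nu theta')).
Proof.
move=> Ot Ot'; split.
- exact: measurable_density.
- exact: measurable_density.
- exact: measurable_log_div.
- exact: measurable_log_div.
- exact: density_ge0.
- exact: density_ge0.
- exact: integral_density.
- exact: integral_density.
- exact: ae_log_ratio_losses.
Qed.

(** * Weighted masses and moments, and recovery of the dual parameter *)

Local Notation weight theta y := (ppow (base theta y) (lam^-1 - 1)).

(** Differentiation under the integral sign, combined with the chain rule for exp phi. *)
Lemma integral_weight_coord theta i : Omega theta ->
  (\int[nu]_y (weight theta y * ((y : 'rV[R]_d) 0 i)%:E) =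
   (expR (phi theta) * grad phi theta 0 i)%:E)%E.
Proof.
move=> Ot; rewrite -(sa_diff_under_int SA)//; congr EFin; rewrite !mxE /partial.
have dphi : differentiable phi theta.
  by have [dphi _] := sa_smooth SA 1%N; exact: dphi.
have dexp : differentiable (@expR R) (phi theta).
  exact/derivable1_diffP/derivable_expR.
rewrite deriveE; last exact: differentiable_comp.
rewrite (diff_comp dphi dexp)/= deriveE//.
by rewrite diff1E//= derive1E derive_val; exact: mulrC.
Qed.

(** A zero density forces lam > 0 and a nonpositive base. Then lam < 1 makes 1/lam - 1 positive, so
    the weight is 0 and not +oo. *)
Lemma weight_eq0 theta y : Omega theta -> density lam nu theta y = 0%E ->
  ppow (base theta y) lam^-1 = 0%E /\ weight theta y = 0%E.
Proof.
move=> Ot /eqP; rewrite /density potentialE//= mule_eq0 eqe.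
rewrite [X in _ || X]gt_eqF ?expR_gt0// orbF => /eqP p0; split => //.
have [b0] := ppow_eq0 p0; rewrite invr_ge0 => l0.
have {}l0 : 0 < lam by rewrite lt_neqAle eq_sym lam_neq0.
by rewrite /ppow (le_gtF b0) subr_lt0 invf_lt1// (lt_gtF lam_lt1).
Qed.

(* Integrates w = w (1 + lam theta.y) - lam theta.(w y). *)
Lemma integral_weight theta : Omega theta ->
  (\int[nu]_y weight theta y =
   (expR (phi theta) * (1 - lam * dot (grad phi theta) theta))%:E)%E.
Proof.
move=> Ot.
pose f i (y : borel R d) :=
  ((lam * theta 0 i)%:E * (weight theta y * ((y : 'rV[R]_d) 0 i)%:E))%E.
have intf i : nu.-integrable setT (f i).
  by apply: integrableZl => //; exact: (sa_integrable SA).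
have intu : nu.-integrable setT (fun y => ppow (base theta y) lam^-1).
  apply/integrableP; split; first exact: measurable_base_ppow.
  under eq_integral do rewrite gee0_abs ?ppow_ge0//.
  by rewrite integral_ppow// ltry.
transitivity
    (\int[nu]_y (ppow (base theta y) lam^-1 - (\sum_(i < d) f i y)%R))%E.
  apply: ae_eq_integral => //.
  - exact: measurable_base_ppow.
  - apply: emeasurable_funB; first exact: measurable_base_ppow.
    by apply: measurable_int; apply: integrable_sum.
  - apply: filterS (ae_support Ot Ot) => y [Yy|[/(weight_eq0 Ot)[p0 w0] _]] _.
      rewrite /f !ppow_gt0 ?base_gt0//; under eq_bigr do rewrite -!EFinM.
      rewrite sumEFin -EFinB; congr EFin.
      rewrite (powR_mulr_pred lam^-1) ?base_gt0//.
      under eq_bigr do rewrite mulrCA -mulrA.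
      by rewrite -!mulr_sumr -/(dot theta y); ring.
    by rewrite /f p0 w0 big1 ?sube0// => i _; rewrite mul0e mule0.
rewrite integralB//; last exact: integrable_sum.
rewrite integral_ppow// integral_sum//.
rewrite (eq_bigr (fun i =>
    (lam * theta 0 i * (expR (phi theta) * grad phi theta 0 i))%:E)); last first.
  move=> i _; rewrite integralZl//; last exact: (sa_integrable SA).
  by rewrite integral_weight_coord.
rewrite sumEFin -EFinB; congr EFin; rewrite /dot mulrBr mulr1 2!mulr_sumr.
by congr (_ - _); apply: eq_bigr => i _; ring.
Qed.

Lemma ae_weight_proportional theta theta' : Omega theta -> Omega theta' ->
  ae_eq nu setT (density lam nu theta) (density lam nu theta') ->
  {ae nu, forall y, (weight theta y =
    (expR ((1 - lam) * (phi theta - phi theta')))%:E * weight theta' y)%E}.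
Proof.
move=> Ot Ot'; apply: filterS2 (ae_support Ot Ot').
move=> y [Yy|[p0 p'0]] pp'; last first.
  have [_ ->] := weight_eq0 Ot p0; have [_ ->] := weight_eq0 Ot' p'0.
  by rewrite mule0.
have := pp' I; rewrite (densityE Ot Yy) (densityE Ot' Yy).
move=> /(@EFin_inj R) /(congr1 (@ln R)).
move=> /(fun e => etrans (etrans (esym (ln_dens Ot Yy)) e) (ln_dens Ot' Yy)).
have [b0 b'0] := (base_gt0 Ot Yy, base_gt0 Ot' Yy).
move=> /(powR_proportional lam_neq0 b0 b'0) bE.
by rewrite (ppow_gt0 _ b0) (ppow_gt0 _ b'0) bE EFinM.
Qed.

Lemma dual_param_ae_inj theta theta' : Omega theta -> Omega theta' ->
  ae_eq nu setT (density lam nu theta) (density lam nu theta') ->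
  dual_param lam nu theta = dual_param lam nu theta'.
Proof.
move=> Ot Ot' /(ae_weight_proportional Ot Ot').
have : expR ((1 - lam) * (phi theta - phi theta')) != 0.
  by rewrite gt_eqF ?expR_gt0.
move: (expR ((1 - lam) * (phi theta - phi theta')))
  (expR_ge0 ((1 - lam) * (phi theta - phi theta'))) => k k_ge0 k0 wE.
have mw t : measurable_fun setT
    ((fun y => weight t y) : borel R d -> \bar R) by exact: measurable_base_ppow.
have mwc t : Omega t -> forall i, measurable_fun setT
    ((fun y => weight t y * (y 0 i)%:E)%E : borel R d -> \bar R).
  by move=> ? i; apply: measurable_int; exact: (sa_integrable SA).
have massE : expR (phi theta) * (1 - lam * dot (grad phi theta) theta) =
    k * (expR (phi theta') * (1 - lam * dot (grad phi theta') theta')).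
  apply: EFin_inj; apply: (etrans (esym (integral_weight Ot))).
  transitivity (k%:E * \int[nu]_y weight theta' y)%E; last first.
    by rewrite (integral_weight Ot').
  rewrite -ge0_integralZl.
  - apply: ae_eq_integral; [exact: measurableT|exact: mw| |].
      by apply: emeasurable_funM; [exact: measurable_cst|exact: mw].
    by apply: filterS wE => y + _.
  - exact: measurableT.
  - exact: mw.
  - by move=> y _; exact: ppow_ge0.
  - by rewrite lee_fin.
have momE i : expR (phi theta) * grad phi theta 0 i =
    k * (expR (phi theta') * grad phi theta' 0 i).
  apply: EFin_inj; apply: (etrans (esym (integral_weight_coord i Ot))).
  transitivity
    (k%:E * \int[nu]_y (weight theta' y * ((y : 'rV[R]_d) 0 i)%:E))%E; last first.
    by rewrite (integral_weight_coord i Ot').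
  (* Coordinates have no sign, so integrability replaces the nonnegativity used for the masses. *)
  rewrite -integralZl; [|exact: measurableT|exact: (sa_integrable SA)].
  apply: ae_eq_integral; [exact: measurableT|exact: mwc| |].
    by apply: emeasurable_funM; [exact: measurable_cst|exact: mwc].
  by apply: filterS wE => y -> _; rewrite muleA.
exact: (proportional_ratio (lt0r_neq0 (expR_gt0 _)) (lt0r_neq0 (expR_gt0 _))
  (lt0r_neq0 (sa_pos SA Ot')) k0 massE momE).
Qed.

End lambda_exponential_family.

(* If the risk is identically +oo on Omega', every point minimizes it, hence the
   proviso on uniqueness of the minimizer. The last clause separates eta from
   every other point without that proviso. *)
Theorem theorem6p4 (R : realType) (d : nat) (lam : R)
    (nu : {measure set (borel R d) -> \bar R}) (Y : set 'rV[R]_d)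
    (lam_lt1 : lam < 1) (lam_neq0 : lam != 0)
    (SA : standing_assumptions lam nu Y)
    (repr : forall y theta, Y y -> nat_params lam nu theta ->
      density lam nu theta y =
      expeR (- log_div lam nu y (dual_param lam nu theta)
             + conjugate lam nu y)%E)
    (theta : 'rV[R]_d) (Htheta : nat_params lam nu theta) :
  let eta := dual_param lam nu theta in
  let Omega' := dual_params lam nu in
  let L := log_div lam nu in
  let risk := fun eta' => expect lam nu theta (fun y => L y eta') in
  [/\ argmin Omega' risk eta,
      (exists2 eta0, Omega' eta0 & (risk eta0 < +oo)%E) ->
        argmin Omega' risk = [set eta]
    & forall eta', Omega' eta' -> eta' <> eta ->
        (0 < expect lam nu theta (fun y => L y eta' - L y eta))%E].
Proof.
move=> eta Omega' L risk.
pose comp t Ot := family_comparison lam_neq0 SA repr (theta' := t) Htheta Ot.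
(* Zero excess would force the two densities to agree almost everywhere, hence the dual parameters
   to coincide. *)
have excess_neq0 t : nat_params lam nu t -> dual_param lam nu t <> eta ->
    expect lam nu theta (fun y => L y (dual_param lam nu t) - L y eta)%E <> 0%E.
  move=> Ot neq excess0; apply: neq; apply: esym.
  apply: (dual_param_ae_inj lam_lt1 lam_neq0 SA Htheta Ot).
  exact: (integral_logratio_eq0 (comp t Ot) excess0).
have eta_min : argmin Omega' risk eta.
  split; first by exists theta.
  by move=> _ [t Ot <-]; exact: (integral_loss_le (comp t Ot)).
split; first exact: eta_min.
- move=> [eta0 Oeta0 fin0]; apply/seteqP; split; last by move=> _ ->.
  move=> _ [[t Ot <-] tmin]; apply: contrapT => neq.
  apply: (excess_neq0 t Ot neq).
  (* A second minimizer has finite risk by comparison with [eta0], and risk at most that of [eta],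
     so its excess would vanish. *)
  apply: (integral_loss_eq (comp t Ot)).
    exact: le_lt_trans (tmin _ Oeta0) fin0.
  by apply: tmin; exists theta.
- move=> _ [t Ot <-] neq; rewrite lt_def; apply/andP; split.
    by apply/eqP; exact: excess_neq0.
  exact: (integral_logratio_ge0 (comp t Ot)).
Qed.
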